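(* Let $\mathcal{M}$ be the maximal admissible invariant set with respect to the system $x(t+1)=A_{\sigma(t)}x(t)$ and the constraints $x(t)\in\mathcal{X}$. Then the following hold. (i) $\mathcal{M}$ is the (unit) sub-level set of a max-polynomial function of degree at most $d$ described by a finite number of pieces; that is, there exist a finite integer $q\ge 1$ and real polynomials $m_1,\dots,m_q$ on $\mathbb{R}^n$, each of degree at most $d$, such that $\mathcal{M}=\{x\in\mathbb{R}^n:\max_{1\le i\le q} m_i(x)\le 1\}$. (ii) If $\mathcal{X}$ is convex, then $\mathcal{M}$ is convex.
   Context: System. Let $\mathcal{A}=\{A_1,\dots,A_M\}\subset\mathbb{R}^{n\times n}$. The switching system is $x(t+1)=A_{\sigma(t)}x(t)$, $t\in\mathbb{N}=\{0,1,2,\dots\}$, where $x(0)\in\mathbb{R}^n$ and $\sigma:\mathbb{N}\to\{1,\dots,M\}$ is an arbitrary switching signal. Constraint set. $\mathcal{X}=\{x\in\mathbb{R}^n: c_i(x)\le 1,\ i=1,\dots,p\}$, where $c_1,\dots,c_p$ are real polynomials of maximum degree $d\ge 1$, with no constant term (all monomials have degree in $\{1,\dots,d\}$). The state constraints are $x(t)\in\mathcal{X}$ for all $t\ge 0$. Standing assumptions. (1) The system is asymptotically stable (under arbitrary switching); equivalently, the joint spectral radius $\rho(\mathcal{A})=\lim_{t\to\infty}\max\{\|A\|^{1/t}: A \text{ a product of } t \text{ elements of } \mathcal{A}\}$ satisfies $\rho(\mathcal{A})<1$. (2) $\mathcal{X}$ is closed, bounded and contains the origin in its interior. Invariance. A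 set $\mathcal{S}\subset\mathbb{R}^n$ is invariant with respect to the system if $x(0)\in\mathcal{S}$ implies $x(t)\in\mathcal{S}$ for all $t\in\mathbb{N}$ and all switching signals; it is admissible invariant if moreover $\mathcal{S}\subseteq\mathcal{X}$. The maximal admissible invariant set $\mathcal{M}$ is the admissible invariant set that contains every admissible invariant set. *)

(* Defs.v *)
From mathcomp Require Import all_boot all_order all_algebra.
From mathcomp Require Import all_classical all_reals all_analysis.
(* The notations of mpoly clash with those of analysis and are not imported;
   thus {mpoly R[n]} is written mpoly.mpoly n R. *)
From mathcomp Require Import (canonicals, coercions) mpoly.

Set Implicit Arguments.
Unset Strict Implicit.
Unset Printing Implicit Defensive.

Import Order.TTheory GRing.Theory Num.Theory.
Import numFieldNormedType.Exports.

Local Open Scope classical_set_scope.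
Local Open Scope ring_scope.

Definition poly_eval (R : realType) (n : nat) (c : mpoly.mpoly n R)
    (x : 'cV[R]_n) : R :=
  mpoly.meval (fun i : 'I_n => x i ord0) c.

Definition mdeg_between (R : realType) (n : nat) (a b : nat)
    (c : mpoly.mpoly n R) : Prop :=
  forall m : mpoly.multinom n, m \in mpoly.msupp c -> (a <= mpoly.mdeg m <= b)%N.

(* Pointwise maximum of a nonempty family, indexed by 'I_q.+1; the maximum is
   seeded with a member of the family, so that no default value interferes. *)
Definition max_poly (R : realType) (n q : nat) (m : 'I_q.+1 -> mpoly.mpoly n R)
    (x : 'cV[R]_n) : R :=
  \big[Num.max/poly_eval (m ord0) x]_(i < q.+1) poly_eval (m i) x.

Definition constraint_set (R : realType) (n p : nat)
    (c : 'I_p -> mpoly.mpoly n R) : set 'cV[R]_n :=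
  [set x | forall i, poly_eval (c i) x <= 1].

Section SwitchingSystem.
Context (R : realType) (n M : nat).
Implicit Types (A : 'I_M -> 'M[R]_n) (sigma : nat -> 'I_M).

Fixpoint traj A sigma (x0 : 'cV[R]_n) (t : nat) : 'cV[R]_n :=
  if t is s.+1 then A (sigma s) *m traj A sigma x0 s else x0.

(* For each switching signal, the origin is Lyapunov stable and globally
   attractive. No uniformity in sigma is required. *)
Definition asymptotically_stable A : Prop :=
  forall sigma,
    (forall e : R, 0 < e -> exists2 delta : R, 0 < delta &
       forall x0, `|x0| < delta -> forall t, `|traj A sigma x0 t| < e) /\
    (forall x0, traj A sigma x0 t @[t --> \oo] --> (0 : 'cV[R]_n)).

Definition invariant_set A (S : set 'cV[R]_n) : Prop :=
  forall x0, S x0 -> forall sigma t, S (traj A sigma x0 t).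

Definition admissible_invariant A (X S : set 'cV[R]_n) : Prop :=
  invariant_set A S /\ S `<=` X.

Definition maximal_admissible_invariant A (X S : set 'cV[R]_n) : Prop :=
  admissible_invariant A X S /\
  forall S', admissible_invariant A X S' -> S' `<=` S.

Lemma maximal_admissible_invariant_exists A (X : set 'cV[R]_n) :
  exists S, maximal_admissible_invariant A X S.
Proof.
exists (\bigcup_(S in admissible_invariant A X) S); split; last first.
  by move=> S' hS' x S'x; exists S'.
split=> [x0 [S [iS sS] Sx0] sigma t|x [S [_ sS] /sS]//].
by exists S => //; exact: iS.
Qed.

End SwitchingSystem.

(* Main.v *)
Require Import Defs.
From mathcomp Require Import all_boot all_order all_algebra.
From mathcomp Require Import all_classical all_reals all_analysis.
From mathcomp Require Import (canonicals, coercions) mpoly.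

Import Order.TTheory GRing.Theory Num.Theory.
Import numFieldNormedType.Exports.

Local Open Scope classical_set_scope.
Local Open Scope ring_scope.

(** The set M consists of the states x such that the product of every finite
word of system matrices sends x into X ([maximal_admissible_invariantE]).
These are infinitely many linear preimages of X, so M inherits convexity from
X at once ([convex_admissible_states]).  Each preimage is cut out by the
polynomials c_i composed with a linear map, which does not raise the degree
([mdeg_between_comp_linear]).  What remains for (i) is that finitely many
words suffice.

Stability is only assumed signal by signal, so uniformity has to come from the
compactness of the space of signals, here in the form of the fan theorem: if
every infinite signal has a prefix in some family, then the length of word
needed to contain such a prefix is bounded.  Along each signal the products
tend to 0, hence every long word starts with a nonempty word whose product
contracts by a prescribed factor ([contracting_prefix]).  With factor 1,
cutting off such prefixes repeatedly bounds all products by a common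
constant K ([words_bounded]); with factor e / K, one cut and this bound make
all long products smaller than e ([words_converge_uniformly]).  As X is
bounded, and contains a ball around 0, all products beyond some length N send
X into that ball, so only the words of length at most N impose a constraint
([finitely_determined]). *)

(** * Words over a finite alphabet *)

(** If the empty word were not barred, some letter could always be appended so
as to stay unbarred, because finitely many bounds have a maximum; the infinite
branch obtained this way would contradict the hypothesis. *)
Lemma fan_theorem {I : finType} (Q : seq I -> Prop)
    (Q_cat : forall w v, Q w -> Q (w ++ v))
    (Q_bar : forall sigma : nat -> I, exists t, Q (mkseq sigma t)) :
  exists T, forall w, (T <= size w)%N -> Q w.
Proof.
pose barred u := exists T, forall v, (T <= size v)%N -> Q (u ++ v).
have barred_step u : (forall i, barred (rcons u i)) -> barred u.
  move=> /choice[T hT]; exists (\max_i T i)%N.+1 => -[//|i v] /= hv.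
  rewrite -cat_rcons; apply: hT.
  exact: leq_trans (leq_bigmax (F := T) i) hv.
have [[T hT]|nbar] := pselect (barred [::]); first by exists T => w /hT.
(* The implication is put under the existential so that [next] is total. *)
have /choice[next hnext] : forall u, exists i, ~ barred u -> ~ barred (rcons u i).
  move=> u; have [bu|nbu] := pselect (barred u); last first.
    by have /existsNP[i ni] := contra_not (barred_step u) nbu; exists i.
  case: (pselect (exists i : I, True)) => [[i _]|noI]; first by exists i.
  case: nbar; exists 1%N => -[//|i v] _.
  by case: noI; exists i.
pose branch := fix branch t :=
  if t is s.+1 then rcons (branch s) (next (branch s)) else [::].
have branchE t : mkseq (fun s => next (branch s)) t = branch t.
  by elim: t => // t IH; rewrite mkseqS IH.
have nbar_branch t : ~ barred (branch t).
  by elim: t => // t; exact: hnext.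
have [t Qt] := Q_bar (fun s => next (branch s)).
case: (nbar_branch t); exists 0%N => v _.
by rewrite -branchE; exact: Q_cat.
Qed.

(** * Products of system matrices *)

(** The last letter acts last, so its matrix is the leftmost factor: this is
the order in which a trajectory meets the matrices. *)
Definition word_mx {R : realType} {n M : nat} (A : 'I_M -> 'M[R]_n)
    (w : seq 'I_M) : 'M[R]_n :=
  foldl (fun B i => A i *m B) 1%:M w.

Section Words.
Context {R : realType} {n M : nat} (A : 'I_M -> 'M[R]_n).
Implicit Types (w u v : seq 'I_M) (x : 'cV[R]_n) (X : set 'cV[R]_n).

Lemma word_mx_rcons w i : word_mx A (rcons w i) = A i *m word_mx A w.
Proof. by rewrite /word_mx foldl_rcons. Qed.

Lemma word_mx_cat u v : word_mx A (u ++ v) = word_mx A v *m word_mx A u.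
Proof.
elim/last_ind: v => [|v i IH]; first by rewrite cats0 mul1mx.
by rewrite -rcons_cat !word_mx_rcons IH mulmxA.
Qed.

Lemma trajE sigma x t : traj A sigma x t = word_mx A (mkseq sigma t) *m x.
Proof.
elim: t => [|t IH] /=; first by rewrite mul1mx.
by rewrite IH mkseqS word_mx_rcons mulmxA.
Qed.

(** A finite word extends to an infinite signal, so that staying in X along all
trajectories is a condition on finite words; the states that satisfy it form
an invariant set because words can be concatenated. *)
Lemma maximal_admissible_invariantE X S : (0 < M)%N ->
  maximal_admissible_invariant A X S ->
  S = [set x | forall w, X (word_mx A w *m x)].
Proof.
move=> hM [[S_inv SX] S_max]; apply/seteqP; split => [x Sx w|].
  have -> : w = mkseq (nth (Ordinal hM) w) (size w) by rewrite mkseq_nth.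
  by rewrite -trajE; apply: SX; exact: S_inv.
apply: S_max; split => [x hx sigma t w|x /(_ [::])]; last by rewrite mul1mx.
by rewrite trajE mulmxA -word_mx_cat; exact: hx.
Qed.

Lemma convex_admissible_states X : convex_set X ->
  convex_set [set x | forall w, X (word_mx A w *m x)].
Proof.
move=> X_conv x y l; rewrite !inE /= => Xx Xy w.
have := X_conv (word_mx A w *m x) (word_mx A w *m y) l.
rewrite !inE => /(_ (Xx w) (Xy w)).
by congr X; rewrite mulmxDr -!scalemxAr.
Qed.

(** * Uniform convergence of the products *)

Lemma norm_entry_le x i : `|x i ord0| <= `|x|.
Proof.
rewrite [leRHS]mx_normrE.
exact: (le_bigmax _ (fun ij => `|x ij.1 ij.2|) (i, ord0)).
Qed.

(** Matrices enter only through their columns, because column j of a product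
is the state reached from the j-th basis vector, to which attractivity applies
directly. *)
Lemma norm_mulmx_le (B : 'M[R]_n) e x :
  0 <= e -> (forall j, `|col j B| <= e) -> `|B *m x| <= n%:R * e * `|x|.
Proof.
move=> e0 Be.
have entry_le i : `|(B *m x) i ord0| <= n%:R * e * `|x|.
  rewrite mxE; apply: (le_trans (ler_norm_sum _ _ _)).
  rewrite -mulrA mulr_natl -[leRHS](_ : \sum_(j < n) e * `|x| = _); last first.
    by rewrite sumr_const card_ord.
  apply: ler_sum => j _; rewrite normrM ler_pM ?norm_entry_le//.
  by have := norm_entry_le (col j B) i; rewrite mxE => /le_trans; apply.
rewrite [leLHS]mx_normrE; apply: bigmax_le => [|[i j] _] /=; last first.
  by rewrite (ord1 j).
by rewrite !mulr_ge0.
Qed.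

(** Containing a contracting prefix is stable under extension, and along each
signal it eventually holds by attractivity at the n basis vectors; the fan
theorem makes the length uniform.  The prefix must be nonempty, since for
e = 1 the empty word would satisfy the bound and give no information. *)
Lemma contracting_prefix (e : R) : asymptotically_stable A -> 0 < e ->
  exists T, forall w, (T <= size w)%N -> exists u v,
    [/\ w = u ++ v, u != [::] & forall x, `|word_mx A u *m x| <= e * `|x|].
Proof.
move=> stableA e0; apply: fan_theorem => [w v [u [u' [-> u0 ule]]]|sigma].
  by exists u, (u' ++ v); rewrite catA.
(* [norm_mulmx_le] costs a factor n; n.+1 avoids dividing by 0. *)
have d0 : 0 < e / n.+1%:R by rewrite divr_gt0.
have : \forall t \near \oo, forall j : 'I_n,
    `|traj A sigma (delta_mx j ord0) t| <= e / n.+1%:R.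
  apply: filter_forall => j; apply: cvgr0_norm_le => //.
  exact: (stableA sigma).2.
(* T.+1 rather than T makes the prefix nonempty. *)
move=> [T _ hT]; exists T.+1, (mkseq sigma T.+1), [::].
split; first by rewrite cats0.
  by rewrite -size_eq0 size_mkseq.
move=> x; apply: le_trans (@norm_mulmx_le _ (e / n.+1%:R) _ (ltW d0) _) _ => [j|].
  by rewrite colE -trajE; apply: hT => /=.
rewrite ler_wpM2r// mulrCA ler_piMr ?(ltW e0)// ler_pdivrMr ?mul1r//.
by rewrite ler_nat.
Qed.

(** A long word starts with a nonempty prefix that does not increase norms, so a
bound valid for the shorter word left after the prefix is valid for the whole
word; by induction a bound for the words of length at most T serves for all. *)
Lemma words_bounded : asymptotically_stable A ->
  exists2 K : R, 0 < K & forall w x, `|word_mx A w *m x| <= K * `|x|.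
Proof.
move=> stableA; have [T hT] := contracting_prefix _ stableA ltr01.
(* The 1 and n.+1 make the one-step bound a at least 1, so that a ^+ size w is
   monotone in the length. *)
pose b : R := 1 + \sum_i \sum_j `|col j (A i)|.
have b_ge1 : 1 <= b.
  by rewrite lerDl; apply: sumr_ge0 => i _; apply: sumr_ge0.
have b_ge0 := le_trans ler01 b_ge1.
pose a : R := n.+1%:R * b.
have a_ge1 : 1 <= a by rewrite -[1]mulr1 ler_pM// ler1n.
have a_ge0 : 0 <= a := le_trans ler01 a_ge1.
have Aa i x : `|A i *m x| <= a * `|x|.
  apply: le_trans (norm_mulmx_le _ b _ b_ge0 _) _ => [j|].
    rewrite /b (bigD1 i)//= (bigD1 j)//= ler_wpDl//.
    by rewrite -addrA lerDl addr_ge0 ?sumr_ge0// => k _; exact: sumr_ge0.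
  by rewrite ler_wpM2r// ler_wpM2r// ler_nat.
have short w x : `|word_mx A w *m x| <= a ^+ size w * `|x|.
  elim/last_ind: w => [|w i IH]; first by rewrite mul1mx mul1r.
  rewrite word_mx_rcons -mulmxA size_rcons exprS -mulrA.
  by apply: le_trans (Aa _ _) _; rewrite ler_wpM2l.
exists (a ^+ T); first by rewrite exprn_gt0// (lt_le_trans ltr01 a_ge1).
move=> w; have [k] := ubnP (size w).
elim: k w => // k IH w hk x.
have [hw|/ltnW/hT[u [v [wE u0 ule]]]] := leqP (size w) T.
  apply: le_trans (short _ _) _.
  by rewrite ler_wpM2r// ler_weXn2l.
rewrite wE word_mx_cat -mulmxA.
apply: le_trans (IH v _ _) _; last first.
  by rewrite ler_wpM2l ?exprn_ge0// (le_trans (ule x))// mul1r.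
rewrite -ltnS; apply: leq_trans hk; rewrite ltnS wE size_cat.
by rewrite -[ltnLHS]add0n ltn_add2r lt0n size_eq0.
Qed.

Lemma words_converge_uniformly (e : R) : asymptotically_stable A -> 0 < e ->
  exists T, forall w x, (T <= size w)%N -> `|word_mx A w *m x| <= e * `|x|.
Proof.
move=> stableA e0; have [K K0 hK] := words_bounded stableA.
have [T hT] := contracting_prefix (e / K) stableA (divr_gt0 e0 K0).
exists T => w x /hT[u [v [-> _ ule]]].
rewrite word_mx_cat -mulmxA; apply: le_trans (hK _ _) _.
by rewrite mulrC -ler_pdivlMr// mulrAC.
Qed.

(** The empty word is among the tested words, so the tested states lie in the
bounded set X; then long products send them into a ball inside X. *)
Lemma finitely_determined X : asymptotically_stable A ->
  bounded_set X -> nbhs (0 : 'cV[R]_n) X ->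
  exists N, forall x, (forall w, (size w <= N)%N -> X (word_mx A w *m x)) ->
    forall w, X (word_mx A w *m x).
Proof.
move=> stableA /pinfty_ex_gt0[b b0 hb] /nbhs_normP[r /= r0 hr].
have e0 : 0 < r / 2 / b by rewrite !divr_gt0.
have [N hN] := words_converge_uniformly _ stableA e0.
(* Halving r turns the weak bound on the products into membership in the open
   ball of radius r. *)
exists N => x hx w; have [/hx//|/ltnW Nw] := leqP (size w) N.
apply: hr => /=; rewrite sub0r normrN.
apply: le_lt_trans (hN _ _ Nw) _.
apply: (@le_lt_trans _ _ (r / 2)); last by rewrite ltr_pdivrMr// ltr_pMr// ltr1n.
rewrite mulrAC ler_pdivrMr// ler_wpM2l ?divr_ge0 ?(ltW r0)//.
by apply: hb; have := hx [::] isT; rewrite mul1mx.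
Qed.

End Words.

(** * Polynomials along a linear map *)

Section Polynomials.
Context {R : realType} {n : nat}.
Implicit Types (P Q : mpoly.mpoly n R) (B : 'M[R]_n) (x : 'cV[R]_n).

Definition linear_form (u : 'rV[R]_n) : mpoly.mpoly n R :=
  \sum_j u ord0 j *: mpoly.mpolyX R (mpoly.mnm1 j).

Definition comp_linear P B : mpoly.mpoly n R :=
  mpoly.comp_mpoly [tuple linear_form (row i B) | i < n] P.

Lemma poly_eval_comp_linear P B x :
  poly_eval (comp_linear P B) x = poly_eval P (B *m x).
Proof.
rewrite /poly_eval mpoly.comp_mpoly_meval; apply: mpoly.meval_eq => i.
rewrite tnth_mktuple mxE raddf_sum /=; apply: eq_bigr => j _.
by rewrite mpoly.mevalZ mpoly.mevalXU mxE.
Qed.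

Lemma mdeg_between_sum {I : eqType} (r : seq I) (F : I -> mpoly.mpoly n R) d :
  (forall i, i \in r -> mdeg_between 0 d (F i)) ->
  mdeg_between 0 d (\sum_(i <- r) F i).
Proof.
move=> hF m /mpoly.msupp_sum_le/flatten_mapP[i].
by rewrite mem_filter => /hF; apply.
Qed.

Lemma mdeg_between_scale a P d : mdeg_between 0 d P -> mdeg_between 0 d (a *: P).
Proof. by move=> hP m /mpoly.msuppZ_le; exact: hP. Qed.

Lemma mdeg_between_mul P Q d e : mdeg_between 0 d P -> mdeg_between 0 e Q ->
  mdeg_between 0 (d + e) (P * Q).
Proof.
move=> hP hQ m /mpoly.msuppM_le/allpairsP[[m1 m2] /= [/hP h1 /hQ h2 ->]].
by rewrite mpoly.mdegD leq_add.
Qed.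

Lemma mdeg_between_one : mdeg_between 0 0 (1 : mpoly.mpoly n R).
Proof. by move=> m; rewrite mpoly.msupp1 inE => /eqP->; rewrite mpoly.mdeg0. Qed.

Lemma mdeg_between_exp P k : mdeg_between 0 1 P -> mdeg_between 0 k (P ^+ k).
Proof.
move=> hP; elim: k => [|k IH]; first exact: mdeg_between_one.
by rewrite exprS -add1n; exact: mdeg_between_mul.
Qed.

Lemma mdeg_between_linear_form u : mdeg_between 0 1 (linear_form u).
Proof.
apply: mdeg_between_sum => j _; apply: mdeg_between_scale => m.
by rewrite mpoly.msuppX inE => /eqP->; rewrite mpoly.mdeg1.
Qed.

Lemma mdeg_between_comp_linear P B d :
  mdeg_between 0 d P -> mdeg_between 0 d (comp_linear P B).
Proof.
move=> hP; rewrite /comp_linear mpoly.comp_mpolyE.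
apply: mdeg_between_sum => m /hP/andP[_ md]; apply: mdeg_between_scale => m' hm'.
apply: leq_trans md; rewrite (mpoly.mdegE m).
suff h : mdeg_between 0 (\sum_(i < n) m i)%N
    (\prod_(i < n) tnth [tuple linear_form (row i B) | i < n] i ^+ m i).
  exact: (h m' hm').
elim/big_ind2: _.
- exact: mdeg_between_one.
- by move=> Q1 d1 Q2 d2; exact: mdeg_between_mul.
by move=> i _; rewrite tnth_mktuple; exact/mdeg_between_exp/mdeg_between_linear_form.
Qed.

(** [max_poly] only accepts families indexed by a nonempty ordinal, whereas the
constraints below are naturally indexed by pairs and words. *)
Lemma finite_family_max_poly {F : finType} (f : F -> mpoly.mpoly n R) d :
  (0 < #|F|)%N -> (forall j, mdeg_between 0 d (f j)) ->
  exists (q : nat) (m : 'I_q.+1 -> mpoly.mpoly n R),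
    (forall i, mdeg_between 0 d (m i)) /\
    [set x | forall j, poly_eval (f j) x <= 1] = [set x | max_poly m x <= 1].
Proof.
case cardF: #|F| => [//|q] _ hf.
pose m (i : 'I_q.+1) := f (enum_val (cast_ord (esym cardF) i)).
exists q, m; split => [i|]; first exact: hf.
apply/seteqP; split => x /= => [hx|/bigmax_leP[_ hx] j].
  by apply: bigmax_le => [|i _]; exact: hx.
have := hx (cast_ord cardF (enum_rank j)) isT.
by rewrite /m cast_ordK enum_rankK.
Qed.

End Polynomials.

Theorem proposition4 (R : realType) (n M p d : nat)
    (hn : (0 < n)%N) (hM : (0 < M)%N) (hp : (0 < p)%N) (hd : (0 < d)%N)
    (A : 'I_M -> 'M[R]_n) (c : 'I_p -> mpoly.mpoly n R)
    (hc : forall i, mdeg_between 1 d (c i))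
    (hstable : asymptotically_stable A)
    (hclosed : closed (constraint_set c))
    (hbounded : bounded_set (constraint_set c))
    (hinterior : interior (constraint_set c) (0 : 'cV[R]_n))
    (S : set 'cV[R]_n)
    (hS : maximal_admissible_invariant A (constraint_set c) S) :
  (exists (q : nat) (m : 'I_q.+1 -> mpoly.mpoly n R),
     (forall i, mdeg_between 0 d (m i)) /\
     S = [set x | max_poly m x <= 1]) /\
  (convex_set (constraint_set c) -> convex_set S).
Proof.
have -> := maximal_admissible_invariantE _ _ _ hM hS.
split; last exact: convex_admissible_states.
have [N hN] := finitely_determined _ _ hstable hbounded hinterior.
(* The words of length at most N are represented, with repetitions, as the
   prefixes of the words of length N. *)
pose f (j : 'I_p * 'I_N.+1 * N.-tuple 'I_M) :=
  comp_linear (c j.1.1) (word_mx A (take j.1.2 j.2)).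
have cardF : (0 < #|{: 'I_p * 'I_N.+1 * N.-tuple 'I_M}|)%N.
  by rewrite !card_prod card_tuple !card_ord !muln_gt0 hp expn_gt0 hM.
have hf j : mdeg_between 0 d (f j).
  by apply: mdeg_between_comp_linear => m /hc/andP[].
have [q [m [hm mE]]] := finite_family_max_poly f d cardF hf.
exists q, m; split => //; rewrite -mE; apply/seteqP; split => x /= hx.
  by move=> j; rewrite poly_eval_comp_linear; exact: hx.
apply: hN => w hw i.
pose s := w ++ nseq (N - size w) (Ordinal hM).
have hs : size s == N by rewrite size_cat size_nseq subnKC.
have := hx (i, Ordinal (hw : size w < N.+1)%N, Tuple hs).
by rewrite poly_eval_comp_linear /= take_size_cat.
Qed.
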